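(* Let $1\le d<\omega$ and let $\mathcal A=(A;E_0,\dots,E_{n-1})$ be an $n$-indexed hyperspace such that $\mathcal A$ does not embed the $\vec S$-halfcube for any $n$-tuple $\vec S$ of subsets of $n$ with $\tau(\vec S)<d$. If $|A|<\aleph_{d-1}$, then $\mathcal A$ has an acceptable coloring.
   Context: An $n$-indexed hyperspace is $\mathcal A=(A;E_0,\dots,E_{n-1})$ with each $E_i$ an equivalence relation on $A$; $[a]_i$ is the $E_i$-class of $a$. A coloring is $\chi:A\to n$; it is acceptable if for every $a\in A$, $i<n$, $\{x\in[a]_i:\chi(x)=i\}$ is finite. $\langle\omega\rangle^m$ is the set of strictly increasing $m$-tuples of natural numbers. For an $n$-tuple $\vec S=\langle S_0,\dots,S_{n-1}\rangle$ of subsets of $m$, the $\vec S$-cube over $\omega$ is $(\omega^m;E_0,\dots,E_{n-1})$ with $\langle x,y\rangle\in E_i$ iff $x_j=y_j$ for all $j\in m\setminus S_i$, and the $\vec S$-halfcube is its substructure with universe $\langle\omega\rangle^m$. An embedding of $\mathcal B$ into $\mathcal A$ is a one-to-one $f:B\to A$ with $[x]_i=[y]_i\iff[f(x)]_i=[f(y)]_i$ for all $x,y\in B$, $i<n$. The transversal number $\tau(\vec S)$ is the least cardinality of a set $T$ with $T\cap S_i\ne\emptyset$ for all $i<n$, and $\tau(\vec S)=\infty$ if some $S_i=\emptyset$. *)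

(* Defs.v *)
From mathcomp Require Import all_boot.
From mathcomp Require Import all_classical.
From Stdlib Require Import RelationClasses.

Set Implicit Arguments.
Unset Strict Implicit.
Unset Printing Implicit Defensive.

Local Open Scope classical_set_scope.
Local Open Scope card_scope.

Record hyperspace (n : nat) := Hyperspace {
  hcarrier :> Type;
  hrel : 'I_n -> hcarrier -> hcarrier -> Prop;
  hrel_equiv : forall i, Equivalence (hrel i)
}.

Definition eclass (n : nat) (A : hyperspace n) (i : 'I_n) (a : A) : set A :=
  [set x | hrel i a x].

Definition acceptable (n : nat) (A : hyperspace n) (chi : A -> 'I_n) : Prop :=
  forall (a : A) (i : 'I_n), finite_set [set x | eclass i a x /\ chi x = i].

Definition embedding (n : nat) (B A : hyperspace n) (f : B -> A) : Prop :=
  injective f /\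
  forall (x y : B) (i : 'I_n),
    eclass i x = eclass i y <-> eclass i (f x) = eclass i (f y).

Definition embeds (n : nat) (A B : hyperspace n) : Prop :=
  exists f : B -> A, embedding f.

Definition sub_rel (n : nat) (A : hyperspace n) (D : set A) (i : 'I_n)
    (x y : {x : A | x \in D}) : Prop :=
  hrel i (val x) (val y).

Lemma sub_rel_equiv (n : nat) (A : hyperspace n) (D : set A) (i : 'I_n) :
  Equivalence (@sub_rel n A D i).
Proof.
have [r s t] := hrel_equiv A i; split; rewrite /sub_rel.
- by move=> x; apply: r.
- by move=> x y; apply: s.
- by move=> x y z; apply: t.
Qed.

Definition substructure (n : nat) (A : hyperspace n) (D : set A) :
  hyperspace n := Hyperspace (@sub_rel_equiv n A D).

Definition cube_rel (n m : nat) (S : 'I_n -> {set 'I_m}) (i : 'I_n)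
    (x y : {ffun 'I_m -> nat}) : Prop :=
  forall j : 'I_m, j \notin S i -> x j = y j.

Lemma cube_rel_equiv (n m : nat) (S : 'I_n -> {set 'I_m}) (i : 'I_n) :
  Equivalence (cube_rel S i).
Proof.
split=> [x j //|x y xy j jS|x y z xy yz j jS].
- by rewrite xy.
- by rewrite xy // yz.
Qed.

Definition cube (n m : nat) (S : 'I_n -> {set 'I_m}) : hyperspace n :=
  Hyperspace (cube_rel_equiv S).

Definition increasing (m : nat) : set {ffun 'I_m -> nat} :=
  [set x | forall j k : 'I_m, j < k -> x j < x k].

Definition halfcube (n m : nat) (S : 'I_n -> {set 'I_m}) : hyperspace n :=
  @substructure n (cube S) (@increasing m).

Definition hits_all (n m : nat) (S : 'I_n -> {set 'I_m})
    (T : {set 'I_m}) : bool :=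
  [forall i, T :&: S i != finset.set0].

(* [None] stands for infinity.  When every [S i] is nonempty, the full set is
   a transversal, so the [arg min] is a genuine minimum. *)
Definition tau (n m : nat) (S : 'I_n -> {set 'I_m}) : option nat :=
  if [exists i, S i == finset.set0] then None
  else Some #|[arg min_(T < finset.setTfor 'I_m | hits_all S T) #|T| ]|.

Definition tau_lt (n m : nat) (S : 'I_n -> {set 'I_m}) (d : nat) : Prop :=
  if tau S is Some t then t < d else False.

Definition card_lt (T U : Type) : Prop :=
  [set: T] #<= [set: U] /\ ~ ([set: U] #<= [set: T]).

Definition succ_card (U T : Type) : Prop :=
  card_lt U T /\ forall V : Type, card_lt U V -> [set: T] #<= [set: V].

(* [is_aleph k T]: T has cardinality aleph_k, where aleph_(k+1) is the least
   cardinal greater than aleph_k. *)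
Fixpoint is_aleph (k : nat) (T : Type) : Prop :=
  match k with
  | 0 => [set: T] #= [set: nat]
  | k'.+1 => exists U : Type, is_aleph k' U /\ succ_card U T
  end.

Definition card_lt_aleph (A : Type) (k : nat) : Prop :=
  exists T : Type, is_aleph k T /\ card_lt A T.

(* Main.v *)
Require Import Defs.
From mathcomp Require Import all_boot zify.
From mathcomp Require Import all_classical.

(** Call an injection [f] of the increasing [m]-tuples into [A] a weak cube if
    every [E_i] has a coordinate [t i] such that changing only that coordinate
    of [s] does not change the [E_i]-class of [f s].  By the canonical Ramsey
    theorem a weak cube contains a halfcube whose transversal number is at most
    [m], so it is enough to show that a set of cardinality at most [aleph_j]
    either has an acceptable coloring with colors in [J] or contains a weak cube
    of dimension at most [j+1] for the relations indexed by [J].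

    This goes by induction on [j].  In the countable case one colors greedily.
    In the inductive step, filter [X] by sets [X_w] of smaller cardinality, each
    closed under Skolem functions, and let [Y_w] be the union of the earlier
    ones.  A point [x] of the layer of [w] may use the colors [i] in [J] whose
    class of [x] misses [Y_w].  If these restricted colorings of the layers all
    exist, they combine to an acceptable coloring.  Otherwise some layer
    contains a weak cube [f] for the free colors, while the other classes of
    the points [f s] meet [Y_w]; reflecting larger and larger finite parts of
    [f] into [Y_w] over these meeting points gives a weak cube with one more
    coordinate, the index of the reflection, which serves the other colors.  *)

Set Implicit Arguments.
Unset Strict Implicit.
Unset Printing Implicit Defensive.

Local Open Scope classical_set_scope.
Local Open Scope card_scope.

(** * The canonical Ramsey theorem *)

Definition strictly_mono (h : nat -> nat) := {homo h : x y / x < y}.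

Lemma strictly_monoS (h : nat -> nat) :
  (forall n, h n < h n.+1) -> strictly_mono h.
Proof. by move=> hS; apply: homo_ltn => //; exact: ltn_trans. Qed.

Lemma strictly_mono_ltn h x y : strictly_mono h -> (h x < h y) = (x < y).
Proof.
move=> mh; apply/idP/idP=> [|/mh //].
case: (ltnP x y) => //; rewrite leq_eqVlt => /predU1P[->|/mh]; first by rewrite ltnn.
by move=> h1 h2; move: (ltn_trans h1 h2); rewrite ltnn.
Qed.

Lemma strictly_mono_inj h : strictly_mono h -> injective h.
Proof.
move=> mh x y e; case: (ltngtP x y) => // /mh; by rewrite e ltnn.
Qed.

Lemma strictly_mono_sorted h s :
  strictly_mono h -> sorted ltn (map h s) = sorted ltn s.
Proof.
by move=> mh; rewrite sorted_map; apply: eq_sorted => x y /=; apply: strictly_mono_ltn.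
Qed.

Lemma sorted_nthP (s : seq nat) :
  (forall k l, k < l -> l < size s -> nth 0 s k < nth 0 s l) <-> sorted ltn s.
Proof.
split=> [H|ss k l kl ls].
  by apply/(sortedP 0) => i iS; apply: H.
by apply: (sorted_ltn_nth ltn_trans 0 ss) => //; rewrite inE ?(ltn_trans kl ls).
Qed.

Lemma infinite_pigeonhole (K : finType) (c : nat -> K) :
  exists k, exists2 u, strictly_mono u & forall n, c (u n) = k.
Proof.
have [k Hk] : exists k, forall N, exists n, N <= n /\ c n = k.
  apply: contrapT => /forallNP H.
  have /choice[N HN] : forall k, exists N, forall n, N <= n -> c n <> k.
    move=> k; have /existsNP[N /forallNP HN] := H k; exists N => n Nn cn.
    exact: (HN n).
  by apply: (HN (c (\max_k N k)) (\max_k N k)) => //; exact: leq_bigmax.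
have /choice[g Hg] := Hk.
pose u := fix u n := if n is n'.+1 then g (u n').+1 else g 0.
exists k, u; first by apply: strictly_monoS => n; case: (Hg (u n).+1).
by case=> [|n]; [case: (Hg 0)|case: (Hg (u n).+1)].
Qed.

(** Induction on [r]: successive thinnings make the color of a tuple depend only on its first entry,
    and the pigeonhole principle then makes it constant. *)
Lemma ramsey (K : finType) r (c : seq nat -> K) :
  exists2 h, strictly_mono h &
  exists k, forall s, sorted ltn s -> size s = r -> c (map h s) = k.
Proof.
elim: r c => [|r IH] c.
  by exists id => //; exists (c [::]) => s _ /size0nil->.
(* For increasing [g], [F g] consists of a subsequence of [g] avoiding [g 0], and of the common
   color of all tuples made of [g 0] followed by [r] increasing terms of that subsequence. *)
have /choice[F HF] : forall g : nat -> nat, exists gk : (nat -> nat) * K,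
    strictly_mono g -> [/\ strictly_mono gk.1,
      forall x, exists2 y, 0 < y & gk.1 x = g y &
      forall s, sorted ltn s -> size s = r -> c (g 0 :: map gk.1 s) = gk.2].
  move=> g; have [h mh [k hk]] := IH (fun s => c (g 0 :: map (g \o succn) s)).
  exists (g \o succn \o h, k) => mg; split=> [x y xy|x|s ss sz] /=.
  - by apply: mg; rewrite ltnS; exact: mh.
  - by exists (h x).+1.
  - by rewrite -(hk s ss sz) -map_comp.
pose G n := iter n (fun g => (F g).1) id.
have mG n : strictly_mono (G n).
  by elim: n => [|n IHn] //=; case: (HF (G n)).
have rG n d x : exists y, G (d + n) x = G n y.
  elim: d x => [|d IHd] x; first by exists x.
  have [_ /(_ x)[y _ e] _] := HF _ (mG (d + n)).
  by have [z e'] := IHd y; exists z; rewrite addSn /= e.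
pose a n := G n 0.
have ma : strictly_mono a.
  apply: strictly_monoS => n; rewrite /a /=.
  by have [_ /(_ 0)[y y0 ->] _] := HF _ (mG n); exact: mG.
have [k [u mu uk]] := infinite_pigeonhole (fun n => (F (G n)).2).
exists (a \o u); first by move=> x y /mu/ma.
exists k; case=> // x s ss [sz].
(* The terms of [a] after [a (u x)] all belong to the thinning made right after [a (u x)] was
   chosen. *)
have /choice[Y HY] : forall m, exists y, u x < m -> a m = G (u x).+1 y.
  move=> m; case: (ltnP (u x) m) => [xm|_]; last by exists 0.
  by have [y e] := rG (u x).+1 (m - (u x).+1) 0; exists y; rewrite -e subnK.
have es : map (a \o u) s = map (G (u x).+1) (map (Y \o u) s).
  rewrite -map_comp; apply/eq_in_map => v vs /=; apply: HY; apply: mu.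
  by move: ss; rewrite /= (path_sortedE ltn_trans) => /andP[/allP/(_ v vs)].
rewrite /= es -(uk x); have [_ _] := HF _ (mG (u x)); apply.
  rewrite -(strictly_mono_sorted _ (mG (u x).+1)) -es strictly_mono_sorted.
    exact: path_sorted ss.
  by move=> v w /mu/ma.
by rewrite size_map.
Qed.

Definition pattern_invariant (I : Type) m (E : I -> seq nat -> seq nat -> Prop) :=
  forall i x y (phi : nat -> nat),
  size x = m -> size y = m -> {in x ++ y &, {homo phi : a b / a < b}} ->
  E i x y <-> E i (map phi x) (map phi y).

Lemma sorted_pad (s : seq nat) n : sorted ltn s -> size s <= n ->
  exists t, sorted ltn (s ++ t) /\ size (s ++ t) = n.
Proof.
move=> ss sn; exists (iota (\max_(v <- s) v).+1 (n - size s)); split; last first.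
  by rewrite size_cat size_iota subnKC.
rewrite (sorted_pairwise ltn_trans) pairwise_cat -!(sorted_pairwise ltn_trans).
rewrite ss iota_ltn_sorted !andbT; apply/allrelP => v w vs; rewrite mem_iota.
case/andP=> + _; apply: leq_trans; rewrite ltnS.
by rewrite (big_rem v vs) /= leq_maxl.
Qed.

(** Both tuples of a pair are read off by index maps [p] and [q] from one increasing [2m]-tuple
    containing all their entries. Each [2m]-tuple is colored by the set of triples [(i, p, q)] for
    which the relation holds, and Ramsey's theorem makes this set constant. *)
Lemma ramsey_pattern (I : finType) m (E : I -> seq nat -> seq nat -> Prop) :
  exists2 h, strictly_mono h &
  pattern_invariant m (fun i x y => E i (map h x) (map h y)).
Proof.
pose mk (p : {ffun 'I_m -> 'I_(m + m)}) z := [seq nth 0 z (p k) | k <- enum 'I_m].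
have [h mh [k hk]] := @ramsey
  {set (I * {ffun 'I_m -> 'I_(m + m)} * {ffun 'I_m -> 'I_(m + m)})} (m + m)
  (fun z => [set t | `[< E t.1.1 (mk t.1.2 z) (mk t.2 z) >]]%SET).
exists h => // i x y phi sx sy mphi.
have mkh p z : size z = m + m -> mk p (map h z) = map h (mk p z).
  by move=> sz; rewrite /mk -map_comp; apply/eq_map => l /=; rewrite (nth_map 0) ?sz.
have key z z' p q : sorted ltn z -> size z = m + m -> sorted ltn z' ->
    size z' = m + m -> E i (map h (mk p z)) (map h (mk q z)) <->
    E i (map h (mk p z')) (map h (mk q z')).
  move=> z1 z2 z1' z2'; have := hk z' z1' z2'; rewrite -(hk z z1 z2) => /setP.
  move/(_ (i, p, q)); rewrite !inE /= !mkh // => e.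
  by split=> /asboolP; [rewrite -e|rewrite e] => /asboolP.
pose z0 := sort leq (undup (x ++ y)).
have z0s : sorted ltn z0 by rewrite ltn_sorted_uniq_leq sort_uniq undup_uniq /= sort_sorted //; exact: leq_total.
have z0m v : (v \in z0) = (v \in x ++ y) by rewrite mem_sort mem_undup.
have z0size : size z0 <= m + m.
  by rewrite size_sort (leq_trans (size_undup _)) // size_cat sx sy.
have [t [ts tsz]] := sorted_pad z0s z0size.
have z0s' : sorted ltn (map phi z0).
  apply/sorted_nthP => a b ab; rewrite size_map => bs.
  rewrite !(nth_map 0) ?(ltn_trans ab) //; apply: mphi; rewrite -?z0m ?mem_nth ?(ltn_trans ab) //.
  by move/sorted_nthP: z0s; apply.
(* Nothing is known of [phi] away from the entries of [x] and [y], so the image of [z0] is padded on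
   its own; the index maps never reach the padding. *)
have := @sorted_pad _ (m + m) z0s'; rewrite size_map => /(_ z0size)[t' [ts' tsz']].
have idx (w : seq nat) : size w = m -> {subset w <= x ++ y} ->
    exists p, mk p (z0 ++ t) = w /\ mk p (map phi z0 ++ t') = map phi w.
  move=> sw wxy.
  have pl (l : 'I_m) : index (nth 0 w l) z0 < size z0.
    by rewrite index_mem z0m wxy // mem_nth ?sw.
  exists [ffun l : 'I_m => Ordinal (leq_trans (pl l) z0size)]; split.
  - apply: (@eq_from_nth _ 0); rewrite size_map size_enum_ord // => l lm.
    rewrite (nth_map (Ordinal lm)) ?size_enum_ord // ffunE /= nth_cat pl.
    by rewrite nth_enum_ord // nth_index // z0m wxy // mem_nth ?sw.
  - apply: (@eq_from_nth _ 0); rewrite /mk size_map size_enum_ord ?size_map // => l lm.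
    rewrite (nth_map (Ordinal lm)) ?size_enum_ord // ffunE /= nth_cat size_map pl.
    rewrite (nth_map 0) // nth_enum_ord // (nth_map 0) ?sw // nth_index //.
    by rewrite z0m wxy // mem_nth ?sw.
have [p [p1 p2]] := idx x sx (fun v vx => ltac:(by rewrite mem_cat vx)).
have [q [q1 q2]] := idx y sy (fun v vx => ltac:(by rewrite mem_cat vx orbT)).
by have := key _ _ p q ts tsz ts' tsz'; rewrite p1 p2 q1 q2.
Qed.

(** * Coordinates that determine the classes of a pattern-invariant equivalence relation *)

Definition update (x : seq nat) j b :=
  mkseq (fun k => if k == j then b else nth 0 x k) (size x).

Lemma size_update x j b : size (update x j b) = size x.
Proof. exact: size_mkseq. Qed.

Lemma nth_update x j b k : k < size x ->
  nth 0 (update x j b) k = if k == j then b else nth 0 x k.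
Proof. by move=> ks; rewrite nth_mkseq. Qed.

Lemma mem_update x j b v : v \in update x j b -> v = b \/ v \in x.
Proof.
case/mapP=> k; rewrite mem_iota /= => ks ->; case: eqP => _; first by left.
by right; rewrite mem_nth.
Qed.

Section Canonical.
Variables (I : finType) (m : nat) (E : I -> seq nat -> seq nat -> Prop).
Hypothesis Erefl : forall i x, E i x x.
Hypothesis Esym : forall i x y, E i x y -> E i y x.
Hypothesis Etrans : forall i x y z, E i x y -> E i y z -> E i x z.
Hypothesis Einv : pattern_invariant m E.

Definition raises x j b := [/\ sorted ltn x, size x = m, nth 0 x j < b &
  sorted ltn (update x j b)].

(** This is the canonical set of Erdős and Rado: by pattern invariance, raising entry [j] either
    always or never preserves the class. *)
Definition relevant i : {set 'I_m} :=
  [set j : 'I_m | `[< forall x b, raises x j b -> ~ E i x (update x j b) >]]%SET.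

(** A raise puts [b] strictly between entry [j] and the next one, so the entries of [x] and
    [update x j b] always form the same order pattern. The map [phi] carries one such configuration
    to the other. *)
Lemma raises_pattern i x b y b' (j : 'I_m) : raises x j b -> raises y j b' ->
  E i x (update x j b) -> E i y (update y j b').
Proof.
move=> [xs xm xb xbs] [ys ym yb ybs].
have below k : k <= j -> nth 0 x k < b.
  rewrite leq_eqVlt => /predU1P[->//|kj]; apply: ltn_trans xb.
  by move/sorted_nthP: xs; apply => //; rewrite xm.
have above k : j < k -> k < m -> b < nth 0 x k.
  move=> jk km; move/sorted_nthP: xbs => /(_ j k jk).
  rewrite size_update xm => /(_ km); rewrite !nth_update ?xm // eqxx.
  by rewrite gtn_eqF.
have below' k : k <= j -> nth 0 y k < b'.
  rewrite leq_eqVlt => /predU1P[->//|kj]; apply: ltn_trans yb.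
  by move/sorted_nthP: ys; apply => //; rewrite ym.
have above' k : j < k -> k < m -> b' < nth 0 y k.
  move=> jk km; move/sorted_nthP: ybs => /(_ j k jk).
  rewrite size_update ym => /(_ km); rewrite !nth_update ?ym // eqxx.
  by rewrite gtn_eqF.
have xu : uniq x by move: xs; rewrite ltn_sorted_uniq_leq => /andP[].
have bx k : k < m -> (nth 0 x k == b) = false.
  move=> km; case: (leqP k j) => [/below|/above/(_ km)]; first by move/ltn_eqF.
  by move/gtn_eqF.
pose phi v := if v == b then b' else nth 0 y (index v x).
have phix k : k < m -> phi (nth 0 x k) = nth 0 y k.
  by move=> km; rewrite /phi bx // index_uniq ?xm.
have phib : phi b = b' by rewrite /phi eqxx.
have mphi : {in x ++ update x j b &, {homo phi : v w / v < w}}.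
  have dec v : v \in x ++ update x j b -> v = b \/ exists2 k, k < m & v = nth 0 x k.
    rewrite mem_cat => /orP[vx|/mem_update[->|vx]]; first last.
    - by right; exists (index v x); rewrite ?nth_index -?xm ?index_mem.
    - by left.
    - by right; exists (index v x); rewrite ?nth_index -?xm ?index_mem.
  move=> v w /dec[->|[k km ->]] /dec[->|[l lm ->]]; rewrite ?phib ?phix //.
  - by rewrite ltnn.
  - move=> bl; apply: above' => //; case: (ltnP j l) => // /below.
    by move=> /(ltn_trans bl); rewrite ltnn.
  - move=> kb; apply: below'; case: (leqP k j) => // /above/(_ km).
    by move=> /(ltn_trans kb); rewrite ltnn.
  - case: (ltnP k l) => [kl _|]; first by move/sorted_nthP: ys; apply; rewrite ?ym.
    rewrite leq_eqVlt => /predU1P[->|lk]; first by rewrite ltnn.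
    have : nth 0 x l < nth 0 x k by move/sorted_nthP: xs; apply; rewrite ?xm.
    by move=> h1 h2; move: (ltn_trans h1 h2); rewrite ltnn.
have ex : map phi x = y.
  apply: (@eq_from_nth _ 0); rewrite size_map xm ?ym // => k km.
  by rewrite (nth_map 0) ?xm // phix.
have eu : map phi (update x j b) = update y j b'.
  apply: (@eq_from_nth _ 0) => [|k].
    by rewrite [LHS]size_map !size_update xm ym.
  rewrite [size _]size_map size_update xm => km.
  rewrite [RHS]nth_update ?ym // (nth_map 0) ?size_update ?xm // nth_update ?xm //.
  by case: eqP => // _; rewrite phix.
by move/(Einv i xm (etrans (size_update x j b) xm) mphi); rewrite ex eu.
Qed.

Lemma irrelevant_raise i (j : 'I_m) x b :
  j \notin relevant i -> raises x j b -> E i x (update x j b).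
Proof.
rewrite inE => /asboolPn/existsNP[y /existsNP[c /not_implyP[yc /contrapT Ey]]] xb.
exact: raises_pattern yc xb Ey.
Qed.

Lemma relevant_le i z x : sorted ltn z -> sorted ltn x -> size z = m ->
  size x = m -> (forall k, k < m -> nth 0 z k <= nth 0 x k) ->
  (forall j : 'I_m, j \in relevant i -> nth 0 z j = nth 0 x j) -> E i z x.
Proof.
move=> zs xs zm xm zx zxC.
(* coordinates are raised from the last one down, which keeps tuples increasing *)
pose v j := mkseq (fun k => if k < j then nth 0 z k else nth 0 x k) m.
have nv j k : k < m -> nth 0 (v j) k = if k < j then nth 0 z k else nth 0 x k.
  by move=> km; rewrite nth_mkseq.
have sv j : size (v j) = m by rewrite size_mkseq.
have vs j : sorted ltn (v j).
  apply/sorted_nthP => k l kl; rewrite sv => lm.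
  rewrite !nv ?(ltn_trans kl lm) //.
  have zkl : nth 0 z k < nth 0 z l by move/sorted_nthP: zs; apply; rewrite ?zm.
  have xkl : nth 0 x k < nth 0 x l by move/sorted_nthP: xs; apply; rewrite ?xm.
  case: (ltnP l j) => lj; first by rewrite (ltn_trans kl lj).
  by case: ifP => // _; apply: leq_trans zkl (zx _ lm).
suff H j : j <= m -> E i z (v (m - j)).
  have -> : x = v 0 by apply: (@eq_from_nth _ 0); rewrite ?sv // xm => k km; rewrite nv.
  by rewrite -(subnn m); exact: H.
elim: j => [_|j IH jm].
  suff -> : v (m - 0) = z by exact: Erefl.
  by rewrite subn0; apply: (@eq_from_nth _ 0); rewrite sv ?zm // => k km; rewrite nv // km.
apply: Etrans (IH (ltnW jm)) _.
have -> : m - j = (m - j.+1).+1 by lia.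
have pm : m - j.+1 < m by lia.
move: (m - j.+1) pm => p pm.
have up : update (v p.+1) p (nth 0 x p) = v p.
  apply: (@eq_from_nth _ 0); rewrite size_update ?sv // => k km.
  rewrite nth_update ?sv // !nv //; case: eqP => [->|/eqP kp]; first by rewrite ltnn.
  by rewrite ltnS leq_eqVlt (negbTE kp).
case: (eqVneq (nth 0 z p) (nth 0 x p)) => [e|ne].
  suff -> : v p.+1 = v p by exact: Erefl.
  rewrite -up; apply: (@eq_from_nth _ 0); rewrite ?size_update ?sv // => k km.
  rewrite nth_update ?sv //; case: eqP => [->|//]; by rewrite nv // ltnSn e.
rewrite -up; apply: (@irrelevant_raise i (Ordinal pm)).
  by apply: contra ne => /zxC /= ->.
split=> //; last by rewrite up.
by rewrite /= nv // ltnSn ltn_neqAle ne zx.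
Qed.

(** The coordinatewise minimum of [x] and [y] is increasing, lies below both and agrees with both on
    the relevant coordinates, so [relevant_le] links each of them to it. *)
Lemma relevant_eq i x y : sorted ltn x -> sorted ltn y -> size x = m ->
  size y = m -> (forall j : 'I_m, j \in relevant i -> nth 0 x j = nth 0 y j) ->
  E i x y.
Proof.
move=> xs ys xm ym xy.
pose z := mkseq (fun k => minn (nth 0 x k) (nth 0 y k)) m.
have nz k : k < m -> nth 0 z k = minn (nth 0 x k) (nth 0 y k).
  by move=> km; rewrite nth_mkseq.
have sz : size z = m by rewrite size_mkseq.
have zs : sorted ltn z.
  apply/sorted_nthP => k l kl; rewrite sz => lm; rewrite !nz ?(ltn_trans kl lm) //.
  have : nth 0 x k < nth 0 x l by move/sorted_nthP: xs; apply; rewrite ?xm.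
  have : nth 0 y k < nth 0 y l by move/sorted_nthP: ys; apply; rewrite ?ym.
  lia.
apply: (@Etrans i x z y); [apply: Esym|]; apply: relevant_le => //.
- by move=> k km; rewrite nz // geq_minl.
- by move=> j /xy e; rewrite nz // -e minnn.
- by move=> k km; rewrite nz // geq_minr.
- by move=> j /xy e; rewrite nz // e minnn.
Qed.

(* Multiples of 3 leave room for moving an entry of [y] off the value [x_j] by 2
   and then [x_j] by 1 without changing the relative order. *)
Lemma relevant_value i x y (j : 'I_m) : sorted ltn x -> sorted ltn y ->
  size x = m -> size y = m -> E i (map (muln 3) x) (map (muln 3) y) ->
  j \in relevant i ->
  exists2 l : 'I_m, l \in relevant i & nth 0 x j = nth 0 y l.
Proof.
move=> xs ys xm ym Exy jR; apply: contrapT => noL.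
pose X := map (muln 3) x; pose Y := map (muln 3) y.
have nX k : k < m -> nth 0 X k = 3 * nth 0 x k by move=> km; rewrite (nth_map 0) ?xm.
have nY k : k < m -> nth 0 Y k = 3 * nth 0 y k by move=> km; rewrite (nth_map 0) ?ym.
have Xm : size X = m by rewrite size_map.
have Ym : size Y = m by rewrite size_map.
have mono3 : strictly_mono (muln 3) by move=> a b ab; lia.
have Xs : sorted ltn X by rewrite strictly_mono_sorted.
have Ys : sorted ltn Y by rewrite strictly_mono_sorted.
pose c := nth 0 X j; have cE : c = 3 * nth 0 x j by rewrite /c nX.
pose psi v := if v == c then v + 2 else v.
pose Z := map psi Y.
have Zm : size Z = m by rewrite size_map.
have nZ k : k < m -> nth 0 Z k = psi (nth 0 Y k) by move=> km; rewrite (nth_map 0) ?Ym.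
have Zs : sorted ltn Z.
  apply/sorted_nthP => k l kl; rewrite Zm => lm; rewrite !nZ ?(ltn_trans kl lm) //.
  have : nth 0 Y k < nth 0 Y l by move/sorted_nthP: Ys; apply; rewrite ?Ym.
  rewrite !nY ?(ltn_trans kl lm) // /psi cE.
  by case: eqP => _; case: eqP => _; lia.
(* By assumption no relevant coordinate of [Y] carries the value [c], so [psi] moves only irrelevant
   coordinates. *)
have EYZ : E i Y Z.
  apply: relevant_eq => // l lR; rewrite nZ // /psi; case: eqP => // e.
  by case: noL; exists l => //; move: e; rewrite nY // cE; lia.
have EXZ : E i X Z by apply: Etrans EYZ.
pose phi v := if v == c then v.+1 else v.
have mphi : {in X ++ Z &, {homo phi : v w / v < w}}.
  have dec v : v \in X ++ Z -> v = c + 2 \/ exists k, v = 3 * k.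
    rewrite mem_cat => /orP[/mapP[k _ ->]|]; first by right; exists k.
    case/mapP => w /mapP[k _ ->] ->; rewrite /psi; case: eqP => [->|_]; first by left.
    by right; exists k.
  move=> v w /dec dv /dec dw; rewrite /phi cE; move: dv dw; rewrite cE.
  by case: eqP => ?; case: eqP => ?; case=> [?|[? ?]]; case=> [?|[? ?]]; lia.
have eX : map phi X = update X j c.+1.
  apply: (@eq_from_nth _ 0); rewrite ?size_update size_map // Xm => k km.
  rewrite (nth_map 0) ?Xm // nth_update ?Xm // /phi /c.
  have Xu : uniq X by move: Xs; rewrite ltn_sorted_uniq_leq => /andP[].
  by rewrite nth_uniq ?Xm //; case: eqP => // ->.
have eZ : map phi Z = Z.
  rewrite -[RHS]map_id; apply/eq_in_map => v /mapP[w /mapP[k _ ->] ->].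
  by rewrite /phi /psi; case: eqP => //; case: eqP => //; lia.
(* Moving [c] to [c + 1] raises [X] at [j] and fixes [Z], so [X] and its raise are both equivalent
   to [Z], although [j] is relevant. *)
have EXZ' : E i (update X j c.+1) Z by move/(Einv i Xm Zm mphi): EXZ; rewrite eX eZ.
move: jR; rewrite inE => /asboolP/(_ X c.+1); apply; last first.
  by apply: Etrans EXZ _; exact: Esym.
split=> //; apply/sorted_nthP => k l kl; rewrite size_update Xm => lm.
have : nth 0 X k < nth 0 X l by move/sorted_nthP: Xs; apply; rewrite ?Xm.
rewrite !nth_update ?Xm ?(ltn_trans kl lm) // !nX ?(ltn_trans kl lm) // cE.
by case: eqP => [->|]; case: eqP => [->|]; lia.
Qed.

Lemma relevant_scaled i x y : sorted ltn x -> sorted ltn y ->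
  size x = m -> size y = m ->
  E i (map (muln 3) x) (map (muln 3) y) <->
  forall j : 'I_m, j \in relevant i -> nth 0 x j = nth 0 y j.
Proof.
move=> xs ys xm ym; split=> [Exy|xy]; last first.
  have mono3 : strictly_mono (muln 3) by move=> a b ab; lia.
  apply: relevant_eq; rewrite ?size_map ?strictly_mono_sorted // => j /xy e.
  by rewrite !(nth_map 0) ?xm ?ym // e.
suff H k (j : 'I_m) : j < k -> j \in relevant i -> nth 0 x j = nth 0 y j.
  by move=> j; exact: (H j.+1).
(* The value [x_j] equals [y_l] for a relevant [l]. If [l < j], induction gives [x_l = y_l = x_j],
   which is impossible; so [j <= l] and [y_j <= x_j]. Exchanging [x] and [y] gives the other
   inequality. *)
elim: k j => // k IH j jk jR.
have [l lR e] := relevant_value xs ys xm ym Exy jR.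
have [l' l'R e'] := relevant_value ys xs ym xm (Esym Exy) jR.
have lej (s : seq nat) (a : 'I_m) : sorted ltn s -> size s = m ->
    j <= a -> nth 0 s j <= nth 0 s a.
  move=> ss sm; rewrite leq_eqVlt => /predU1P[->//|ja].
  by apply: ltnW; move/sorted_nthP: ss; apply; rewrite ?sm.
have ltj (s : seq nat) (a : 'I_m) : sorted ltn s -> size s = m ->
    a < j -> nth 0 s a < nth 0 s j.
  by move=> ss sm aj; move/sorted_nthP: ss; apply; rewrite ?sm.
apply/eqP; rewrite eqn_leq; apply/andP; split.
- rewrite e'; apply: lej => //; case: (leqP j l') => // lj.
  have := ltj _ _ ys ym lj; rewrite e' (IH l') ?ltnn //.
  exact: leq_trans lj _.
- rewrite e; apply: lej => //; case: (leqP j l) => // lj.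
  have := ltj _ _ xs xm lj; rewrite e (IH l) ?ltnn //.
  exact: leq_trans lj _.
Qed.

End Canonical.

(** The Erdős-Rado theorem for finitely many equivalence relations at once; the factor 3 of
    [relevant_scaled] is absorbed into [h]. *)
Lemma canonical_ramsey (I : finType) m (E : I -> seq nat -> seq nat -> Prop) :
  (forall i, RelationClasses.Equivalence (E i)) ->
  exists2 h, strictly_mono h & exists C : I -> {set 'I_m},
  forall i x y, sorted ltn x -> sorted ltn y -> size x = m -> size y = m ->
  E i (map h x) (map h y) <-> forall j, j \in C i -> nth 0 x j = nth 0 y j.
Proof.
move=> eqE; have [h mh hE] := ramsey_pattern m E.
exists (h \o muln 3); first by move=> x y xy; apply: mh; lia.
exists (relevant m (fun i x y => E i (map h x) (map h y))) => i x y xs ys xm ym.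
rewrite (map_comp h _ x) (map_comp h _ y); apply: relevant_scaled => //.
- by move=> k u; case: (eqE k) => r _ _; exact: r.
- by move=> k u v; case: (eqE k) => _ s _; exact: s.
- by move=> k u v w; case: (eqE k) => _ _ t; exact: t.
Qed.

(** * Cardinality and closure under finitary operations *)

Record wellorder (W : Type) (le : W -> W -> Prop) : Prop := Wellorder {
  wo_total : forall x y, le x y \/ le y x;
  wo_trans : forall y x z, le x y -> le y z -> le x z;
  wo_anti : forall x y, le x y -> le y x -> x = y;
  wo_min : forall P : set W, P !=set0 -> exists z, P z /\ forall x, P x -> le z x
}.

(** The well-ordering principle provides unique least elements; totality, antisymmetry and
    transitivity are read off from sets of two or three points. *)
Lemma wellorder_exists (W : Type) : exists le : W -> W -> Prop, wellorder le.
Proof.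
have [R Rwo] := wochoice.well_ordering_principle {classic W}.
have min (P : set W) : P !=set0 -> exists z, (P z /\ forall x, P x -> R z x) /\
    forall z', P z' /\ (forall x, P x -> R z' x) -> z = z'.
  move=> [x Px]; have [|z [[zP zmin] zu]] := Rwo [pred x : {classic W} | `[< P x >]].
    by exists x; apply/asboolP.
  move/asboolP in zP; exists z; split.
    by split=> // y Py; apply: zmin; apply/asboolP.
  move=> z' [z'P z'min]; apply: zu; split; first by apply/asboolP.
  by move=> y /asboolP; exact: z'min.
have tot x y : R x y \/ R y x.
  have [|z [[[->|->] zm] _]] := min [set x; y]; first by exists x; left.
    by left; apply: zm; right.
  by right; apply: zm; left.
have Rxx x : R x x by case: (tot x x).
have anti x y : R x y -> R y x -> x = y.
  move=> xy yx; have [|z [_ zu]] := min [set x; y]; first by exists x; left.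
  have <- : z = x by apply: zu; split; [left|move=> _ [->|->]].
  by apply: zu; split; [right|move=> _ [->|->]].
exists R; split=> // [y x z xy yz|P /min[z [? _]]]; last by exists z.
have [|t [[[[->|->]|->] tm] _]] := min [set x; y; z]; first by exists x; left; left.
- by apply: tm; right.
- by rewrite (anti x y) //; apply: tm; left; left.
- by rewrite -(anti y z) //; apply: tm; left; right.
Qed.

Lemma wellorder_sub (W : Type) (le : W -> W -> Prop) (D : set W) :
  wellorder le -> wellorder (fun x y : {x | D x} => le (sval x) (sval y)).
Proof.
move=> [tot trans anti min]; split=> [x y|y x z|x y xy yx|P [x Px]].
- exact: tot.
- exact: trans.
- by case: x y xy yx => [x Dx] [y Dy] /= xy yx; apply: eq_exist; exact: anti.
- have [|z [[y Py <-] zm]] := min (sval @` P); first by exists (sval x), x.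
  by exists y; split=> // v Pv; apply: zm; exists v.
Qed.

(* [small j X] holds when [X] has cardinality at most [aleph_j]; the recursive form
   makes closure under finitary operations provable without cardinal arithmetic. *)
Fixpoint small (j : nat) (T : Type) (X : set T) : Prop :=
  if j is j'.+1 then
    exists (W : Type) (le : W -> W -> Prop) (rk : T -> W),
      wellorder le /\ forall w, small j' [set x | X x /\ le (rk x) w]
  else countable X.

Lemma small_inj j (T U : Type) (f : T -> U) (X : set T) (Z : set U) :
  (forall x y, X x -> X y -> f x = f y -> x = y) ->
  (forall x, X x -> Z (f x)) -> small j Z -> small j X.
Proof.
elim: j X Z => [|j IH] X Z finj XZ /=.
  move=> /countable_injP[g ginj]; apply/countable_injP; exists (g \o f).
  move=> x y /set_mem Xx /set_mem Xy /= e; apply: finj => //.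
  by apply: ginj => //; apply/mem_set; exact: XZ.
move=> [W [le [rk [wo H]]]]; exists W, le, (rk \o f); split=> // w.
apply: IH (H w) => [x y [Xx _] [Xy _]|x [Xx xw]]; first exact: finj.
by split=> //; exact: XZ.
Qed.

Lemma small_sub j T (X Y : set T) : X `<=` Y -> small j Y -> small j X.
Proof. by move=> XY; apply: (@small_inj j T T id). Qed.

Lemma small_countable j T (X : set T) : countable X -> small j X.
Proof.
elim: j X => // j IH X cX; exists unit, (fun _ _ => True), (fun=> tt); split.
  split=> [||[] []|P [[] Px]] //; first by left.
  by exists tt.
by move=> w; apply: IH; apply: sub_countable cX; apply: subset_card_le => x [].
Qed.

Lemma small_addpoint j T (X : set T) a : small j X -> small j (X `|` [set a]).
Proof.
elim: j X => [|j IH] X /=.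
  move=> cX; rewrite -bigcup2E; apply: bigcup_countable => // -[|[|n]] _ //=.
move=> [W [le [rk [wo H]]]]; exists W, le, rk; split=> // w.
by apply: small_sub (IH _ (H w)) => y [[Xy|->] yw]; [left|right].
Qed.

Section Closure.
Variables (T : eqType) (C : countType) (op : C -> seq T -> seq T).

Inductive op_closure (X : set T) : T -> Prop :=
| op_closure_in x : X x -> op_closure X x
| op_closure_op c s y :
    (forall z, z \in s -> op_closure X z) -> y \in op c s -> op_closure X y.

Lemma op_closure_mono X Y : X `<=` Y -> op_closure X `<=` op_closure Y.
Proof.
move=> XY x; elim=> [z /XY|c s y _ IH ys]; first exact: op_closure_in.
exact: op_closure_op IH ys.
Qed.

(** Every element of the closure is the value of a finite term, coded as a tree: leaves are codes of
    elements of [X], and a node stores an operation and a position in its output list. *)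
Lemma op_closure_countable X : countable X -> countable (op_closure X).
Proof.
move=> /countable_injP[g ginj]; apply/countable_injP.
have [[x0 _]|noT] := pselect (exists x : T, True); last first.
  by exists (fun=> 0) => x; case: noT; exists x.
have /choice[e He] : forall n, exists x, (exists2 x', X x' & g x' = n) ->
    X x /\ g x = n.
  move=> n; have [[x Xx gx]|no] := pselect (exists2 x', X x' & g x' = n).
    by exists x.
  by exists x0 => /no.
have eg x : X x -> e (g x) = x.
  move=> Xx; have [|Xe ge] := He (g x); first by exists x.
  by apply: ginj ge; apply/mem_set.
pose eval := fix eval (t : GenTree.tree nat) : T := match t with
  | GenTree.Leaf n => e n
  | GenTree.Node n ts =>
      if (unpickle n : option (C * nat)) is Some ck
      then nth x0 (op ck.1 (map eval ts)) ck.2 else x0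
  end.
have evalP y : exists t, op_closure X y -> eval t = y.
  have [cy|] := pselect (op_closure X y); last by exists (GenTree.Leaf 0).
  suff [t <-] : exists t, eval t = y by exists t.
  elim: cy => [x Xx|c s z _ IH zs]; first by exists (GenTree.Leaf (g x)); exact: eg.
  have /choice[tr Htr] : forall v, exists t, v \in s -> eval t = v.
    move=> v; case: (boolP (v \in s)) => [/IH[t]|_]; first by exists t.
    by exists (GenTree.Leaf 0).
  exists (GenTree.Node (pickle (c, index z (op c s))) (map tr s)).
  rewrite /= pickleK /= -map_comp (_ : map _ s = s) ?nth_index //.
  by rewrite -[RHS]map_id; apply/eq_in_map.
have [t Ht] := choice evalP.
exists (pickle \o t) => x y /set_mem cx /set_mem cy /= /(pcan_inj pickleK) e'.
by rewrite -(Ht x) // e' Ht.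
Qed.

(** An element of the closure is generated by finitely many points, hence by an initial part [Xw w]
    of [X]. The least such [w] serves as its rank, and induction applies to the closure of
    [Xw w]. *)
Lemma op_closure_small j X : small j X -> small j (op_closure X).
Proof.
elim: j X => [|j IH] X; first exact: op_closure_countable.
move=> [W [le [rk [wo H]]]].
pose Xw w := [set x | X x /\ le (rk x) w].
have Xwm v w : le v w -> op_closure (Xw v) `<=` op_closure (Xw w).
  by move=> vw; apply: op_closure_mono => x [Xx xv]; split=> //; exact: wo_trans xv vw.
have ex y : op_closure X y -> exists w, op_closure (Xw w) y.
  elim=> [x Xx|c s z _ IHs zs].
    by exists (rk x); apply: op_closure_in; split=> //; case: (wo_total wo (rk x) (rk x)).
  suff [w Hw] : exists w, forall v, v \in s -> op_closure (Xw w) v.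
    by exists w; exact: op_closure_op Hw zs.
  elim: s IHs {zs} => [_|v s IHs Hs]; first by exists (rk z).
  have [w Hw] := IHs (fun v' v's => Hs v' (mem_behead (s := v :: s) v's)).
  have [w' Hw'] := Hs v (mem_head _ _).
  case: (wo_total wo w w') => ww'.
    by exists w' => v'; rewrite inE => /predU1P[->//|/Hw]; exact: Xwm.
  by exists w => v'; rewrite inE => /predU1P[->|/Hw //]; exact: Xwm Hw'.
have /choice[mu Hmu] : forall y, exists w, op_closure X y ->
    op_closure (Xw w) y /\ forall v, op_closure (Xw v) y -> le w v.
  move=> y; have [cy|no] := pselect (op_closure X y); last by exists (rk y).
  have [|w [Hw wm]] := wo_min wo (P := [set w | op_closure (Xw w) y]); last by exists w.
  exact: ex.
exists W, le, mu; split=> // w; apply: small_sub (IH _ (H w)) => y [cy yw].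
by apply: Xwm yw _ _; case: (Hmu y cy).
Qed.

End Closure.

(** * Skolem functions and reflection of finite configurations *)

Section Reflection.
Variables (T : eqType) (K : finType) (R : K -> T -> T -> Prop).

Definition atomic_type (u : seq T) : seq (seq (seq bool)) :=
  [seq [seq [seq `[< R k x y >] | y <- u] | x <- u] | k <- enum K].

Lemma atomic_typeP x0 u v k a b : atomic_type u = atomic_type v ->
  size u = size v -> a < size u -> b < size u ->
  R k (nth x0 u a) (nth x0 u b) <-> R k (nth x0 v a) (nth x0 v b).
Proof.
move=> e suv au bu.
have nt w : a < size w -> b < size w ->
    nth false (nth [::] (nth [::] (atomic_type w) (index k (enum K))) a) b =
    `[< R k (nth x0 w a) (nth x0 w b) >].
  move=> aw bw; rewrite (nth_map k) ?index_mem ?mem_enum // nth_index ?mem_enum //.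
  by rewrite (nth_map x0) // (nth_map x0).
have := nt u au bu; rewrite e nt -?suv // => e'.
by split=> /asboolP; [rewrite -e'|rewrite e'] => /asboolP.
Qed.

(** A finite form of existential elementarity: [p] lists the parameters, and [psi] moves the
    witnesses [b] into [Y]. *)
Definition reflects (X Y : set T) := forall p b : seq T,
  (forall x, x \in p -> Y x) -> (forall x, x \in b -> X x) ->
  exists psi : T -> T, [/\ forall x, x \in p -> psi x = x,
    forall x, x \in b -> Y (psi x) &
    forall k x y, x \in p ++ b -> y \in p ++ b ->
      R k (psi x) (psi y) <-> R k x y].

Definition op_closed (C : Type) (op : C -> seq T -> seq T) (Y : set T) :=
  forall c s, (forall z, z \in s -> Y z) -> forall z, z \in op c s -> Y z.

(** The index of an operation prescribes a length and an atomic type; the operation returns a tuple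
    from [X] that realizes this type over its arguments, if there is one. Types are finite boolean
    data, so there are only countably many operations. *)
Lemma skolem (X : set T) : exists op : nat * seq (seq (seq bool)) -> seq T -> seq T,
  (forall c s z, z \in op c s -> X z) /\
  forall Y, op_closed op Y -> reflects X Y.
Proof.
have [op Hop] : exists op : nat * seq (seq (seq bool)) -> seq T -> seq T,
    forall c s, (forall z, z \in op c s -> X z) /\
    forall b, (forall z, z \in b -> X z) -> c = (size b, atomic_type (s ++ b)) ->
    size (op c s) = size b /\ atomic_type (s ++ op c s) = atomic_type (s ++ b).
  have /choice[g Hg] : forall cs : (nat * seq (seq (seq bool))) * seq T,
      exists b', (forall z, z \in b' -> X z) /\
      forall b, (forall z, z \in b -> X z) ->
      cs.1 = (size b, atomic_type (cs.2 ++ b)) ->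
      size b' = size b /\ atomic_type (cs.2 ++ b') = atomic_type (cs.2 ++ b).
    move=> [c s] /=; have [[b Xb ce]|no] := pselect (exists2 b,
      forall z, z \in b -> X z & c = (size b, atomic_type (s ++ b))).
      by exists b; split=> // b1 _; rewrite ce => -[].
    by exists [::]; split=> // b Xb ce; case: no; exists b.
  by exists (fun c s => g (c, s)) => c s; exact: (Hg (c, s)).
exists op; split=> [c s|Y Ycl p b pY bX]; first by case: (Hop c s).
have [_ /(_ b bX erefl)[]] := Hop (size b, atomic_type (p ++ b)) p.
set b' := op _ _ => sb' tb'.
have b'Y z : z \in b' -> Y z by apply: Ycl.
have [[x0 _]|noT] := pselect (exists x : T, True); last first.
  by exists id; split=> // x; case: noT; exists x.
(* Since [index] finds the first occurrence, entries of [b] that already occur in [p] stay fixed,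
   and repetitions in [b] are harmless. *)
exists (fun x => nth x0 (p ++ b') (index x (p ++ b))); split.
- by move=> x xp; rewrite index_cat xp nth_cat index_mem xp nth_index.
- move=> x xb; have : nth x0 (p ++ b') (index x (p ++ b)) \in p ++ b'.
    by rewrite mem_nth // size_cat sb' -size_cat index_mem mem_cat xb orbT.
  by rewrite mem_cat => /orP[/pY|/b'Y].
- move=> k x y xpb ypb.
  rewrite (@atomic_typeP x0 (p ++ b') (p ++ b)) ?size_cat ?sb' // -?size_cat ?index_mem //.
  by rewrite !nth_index.
Qed.

End Reflection.

(** * Comparison of cardinals and smallness of the alephs *)

Lemma cardinal_total (T U : Type) :
  (exists f : T -> U, injective f) \/ (exists f : U -> T, injective f).
Proof.
pose P := [set G : set (T * U) | forall p q, G p -> G q -> (p.1 = q.1 <-> p.2 = q.2)].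
have [F FP Ftot|G [PG Gmax]] := @Zorn_bigcup _ P.
  move=> p q [X FX Xp] [Y FY Yq].
  case: (Ftot X Y FX FY) => XY; first by apply: (FP _ FY); [exact: XY|].
  by apply: (FP _ FX) => //; exact: XY.
have [/choice[f Hf]|/existsNP[x /forallNP Hx]] := pselect (forall x, exists y, G (x, y)).
  by left; exists f => x x' e; apply/(PG _ _ (Hf x) (Hf x')).
have [/choice[f Hf]|/existsNP[y /forallNP Hy]] := pselect (forall y, exists x, G (x, y)).
  by right; exists f => y y' e; apply/(PG _ _ (Hf y) (Hf y')).
case: (Gmax (G `|` [set (x, y)])).
  by split=> [z|/(_ (x, y)) H]; [left|apply: (Hx y); apply: H; right].
move=> [a b] [c d] [Gab|[-> ->]] [Gcd|[-> ->]] //=; first exact: (PG _ _ Gab Gcd).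
  by split=> e; [case: (Hx b)|case: (Hy a)]; rewrite -e.
by split=> e; [case: (Hx d)|case: (Hy c)]; rewrite e.
Qed.

Lemma card_le_injP (T U : Type) :
  [set: T] #<= [set: U] <-> exists f : T -> U, injective f.
Proof.
split=> [/card_leP[g]|[f finj]].
  exists (fun x => val (g (SigSub (mem_set (I : [set: T] x))))) => x y e.
  have /(congr1 val) : SigSub (mem_set (I : [set: T] x)) = SigSub (mem_set (I : [set: T] y)).
    by apply: (@inj _ _ _ g); rewrite ?inE //; exact: val_inj.
  by [].
have /injfunPex[g] : exists2 g : T -> U, set_fun [set: T] [set: U] g & set_inj [set: T] g.
  by exists f => // x y _ _; exact: finj.
exact: inj_card_le.
Qed.

(** No proper initial segment of the order pulled back along [f] contains a copy of [U]. By
    minimality of the successor cardinal such a segment is not larger than [U'], so it injects into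
    [U']. *)
Lemma small_succ_card k (U' U W : Type) (le : W -> W -> Prop) (f : U -> W) :
  succ_card U' U -> small k [set: U'] -> wellorder le -> injective f ->
  (forall w, ~ exists2 g : U -> U, injective g & forall y, ~ le w (f (g y))) ->
  small k.+1 [set: U].
Proof.
move=> [_ Umin] sU' wo finj noU; exists W, le, f; split=> // w.
have sV : small k [set y | ~ le w (f y)].
  have [[h hinj]|noh] := pselect (exists h : {y | ~ le w (f y)} -> U', injective h).
    have [[y0 y0w]|no] := pselect (exists y, ~ le w (f y)); last first.
      apply: (@small_sub _ _ _ set0); last exact/small_countable/countable0.
      by move=> y yw; apply: no; exists y.
    have /choice[h' Hh'] : forall y, exists u, forall p : ~ le w (f y), u = h (exist _ y p).
      move=> y; have [p|np] := pselect (~ le w (f y)).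
        by exists (h (exist _ y p)) => p'; congr (h _); exact: eq_exist.
      by exists (h (exist _ y0 y0w)) => p; case: (np p).
    apply: (@small_inj _ _ _ h' _ [set: U']) => // x y xw yw.
    by rewrite (Hh' x xw) (Hh' y yw) => /hinj[].
  have lt : card_lt U' {y | ~ le w (f y)}.
    split; last by move=> /card_le_injP.
    by apply/card_le_injP; case: (cardinal_total U' {y | ~ le w (f y)}).
  have /card_le_injP[g ginj] := Umin _ lt.
  case: (noU w); exists (sval \o g); last by move=> y /=; case: (g y).
  by move=> x y /= e; apply: ginj; case: (g x) (g y) e => [a pa] [b pb] /= e; exact: eq_exist.
(* The definition of [small] uses closed initial segments, which exceed the open ones by at most one
   point. *)
have [[y0 y0w]|no] := pselect (exists y, f y = w); last first.
  apply: small_sub sV => y [_ yw] wy; apply: no; exists y; exact: wo_anti yw wy.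
apply: small_sub (small_addpoint y0 sV) => y [_ yw].
have [wy|] := pselect (le w (f y)); last by left.
by right; apply: finj; rewrite y0w; exact: wo_anti yw wy.
Qed.

Lemma aleph_small k U : is_aleph k U -> small k [set: U].
Proof.
elim: k U => [|k IH] U /=.
  by move=> /eq_countable e; rewrite /countable in e *; rewrite e.
move=> [U' [/IH sU' sc]].
have [le wo] := wellorder_exists U.
(* an initial segment of least order type among those of cardinality |U| *)
pose P := [set x | exists2 g : U -> U, injective g & forall y, ~ le x (g y)].
have [/(wo_min wo)[x [[f finj fx] xmin]]|noP] := pselect (P !=set0); last first.
  apply: (small_succ_card sc sU' wo (f := id)) => // w [g ginj gw].
  by apply: noP; exists w, g.
apply: (small_succ_card sc sU' (wellorder_sub [set y | ~ le x y] wo)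
  (f := fun y => exist _ (f y) (fx y))) => [y z [/finj]//|[w xw] [g ginj gw]].
apply: (xw); apply: xmin; exists (f \o g); last exact: gw.
exact: inj_comp.
Qed.

Lemma card_lt_aleph_small k A : card_lt_aleph A k.+1 -> small k [set: A].
Proof.
move=> [T [[U [aU [_ Tmin]]] [_ nTA]]].
have [[f finj]|no] := pselect (exists f : A -> U, injective f).
  by apply: (small_inj (f := f)) (aleph_small aU) => // x y _ _; exact: finj.
case: nTA; apply: Tmin; split; last by move=> /card_le_injP.
by apply/card_le_injP; case: (cardinal_total A U).
Qed.

(** * Colorings and weak cubes *)

Lemma finite_set_fibers (T : Type) (K : finType) (c : T -> K) (S : set T) :
  (forall k, finite_set [set x | S x /\ c x = k]) -> finite_set S.
Proof.
move=> H; have -> : S = \bigcup_(k in [set: K]) [set x | S x /\ c x = k].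
  by apply/seteqP; split=> [x Sx|x [k _ []] //]; exists (c x).
by apply: bigcup_finite => //; exact: finite_finset.
Qed.

Lemma infinite_set_seq (T : Type) (S : set T) : infinite_set S ->
  exists2 e : nat -> T, injective e & forall n, S (e n).
Proof.
move=> /infiniteP/card_leP[g].
exists (fun n => val (g (SigSub (mem_set (I : [set: nat] n))))) => [x y e|n].
  have /(congr1 val) : SigSub (mem_set (I : [set: nat] x)) = SigSub (mem_set (I : [set: nat] y)).
    by apply: (@inj _ _ _ g); rewrite ?inE //; exact: val_inj.
  by [].
exact: set_valP.
Qed.

Definition increasing_seq m (s : seq nat) := sorted ltn s && (size s == m).

Lemma increasing_seqP m s : increasing_seq m s -> sorted ltn s /\ size s = m.
Proof. by case/andP=> ? /eqP. Qed.

Fixpoint words N m : seq (seq nat) :=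
  if m is m'.+1 then [seq x :: s | x <- iota 0 N, s <- words N m'] else [:: [::]].

Lemma mem_words N m s : (s \in words N m) = (size s == m) && all (gtn N) s.
Proof.
elim: m s => [|m IH] [|x s] //=.
  by apply/negP => /allpairsP[[y u] [_ _]].
apply/allpairsP/idP => [[[y u] /= [yN uw [-> ->]]]|/and3P[sm xN sN]].
  by move: yN uw; rewrite mem_iota IH eqSS => /= -> /andP[-> ->].
by exists (x, s); rewrite /= mem_iota IH sN -eqSS sm.
Qed.

Section Dichotomy.
Variables (I : finType) (i0 : I) (T : eqType) (E : I -> T -> T -> Prop).
Hypothesis Eequiv : forall i, RelationClasses.Equivalence (E i).

Let Erefl i x : E i x x. Proof. by case: (Eequiv i) => r _ _; exact: r. Qed.
Let Esym i x y : E i x y -> E i y x.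
Proof. by case: (Eequiv i) => _ s _; exact: s. Qed.
Let Etrans i y x z : E i x y -> E i y z -> E i x z.
Proof. by case: (Eequiv i) => _ _ t; exact: t. Qed.

Definition colorable (J : {set I}) (X : set T) := exists chi : T -> I,
  (forall x, X x -> chi x \in J) /\
  forall a i, finite_set [set x | [/\ X x, E i a x & chi x = i]].

(** Surjectivity of [t] onto the coordinates bounds the dimension by the number of relations, which
    later allows the cube to be stretched to [n]-tuples. *)
Record weak_cube (J : {set I}) (X : set T) (m : nat) (f : seq nat -> T)
    (t : I -> nat) : Prop := WeakCube {
  wc_dim : forall i, i \in J -> t i < m;
  wc_onto : forall k, k < m -> exists2 i, i \in J & t i = k;
  wc_val : forall s, increasing_seq m s -> X (f s);
  wc_inj : forall s s', increasing_seq m s -> increasing_seq m s' ->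
    f s = f s' -> s = s';
  wc_rel : forall i s s', i \in J -> increasing_seq m s -> increasing_seq m s' ->
    (forall k, k != t i -> nth 0 s k = nth 0 s' k) -> E i (f s) (f s')
}.

Definition has_weak_cube d J X := exists m f t, m <= d /\ weak_cube J X m f t.

(* Color [x] by the relation whose class of [x] is met as late as possible in an
   enumeration of [X]. *)
Lemma countable_dichotomy J X : countable X -> colorable J X \/ has_weak_cube 1 J X.
Proof.
move=> /countable_injP[g ginj].
have {}ginj x y : X x -> X y -> g x = g y -> x = y.
  by move=> Xx Xy; apply: ginj; exact/mem_set.
have [[x0 Xx0]|noX] := pselect (exists x, X x); last first.
  left; exists (fun=> i0); split=> [x Xx|a i]; first by case: noX; exists x.
  rewrite (_ : [set x | _] = set0); first exact: finite_set0.
  by apply/seteqP; split=> // x [Xx _ _]; case: noX; exists x.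
(* Without colors, a single point of [X] is a weak cube of dimension 0. *)
have [J0|[j0 j0J]] := set_0Vmem J.
  right; exists 0, (fun=> x0), (fun=> 0); split=> //.
  split=> // [i|s s' /increasing_seqP[_ /size0nil->] /increasing_seqP[_ /size0nil->]//].
  by rewrite J0 inE.
have [[a [Xa ainf]]|fin] := pselect (exists a, X a /\
    infinite_set [set x | X x /\ forall i, i \in J -> E i a x]).
  have [e einj eS] := infinite_set_seq ainf.
  right; exists 1, (fun s => e (head 0 s)), (fun=> 0); split=> //; split=> //.
  - by case=> // _; exists j0.
  - by move=> s _; case: (eS (head 0 s)).
  - move=> s s' /increasing_seqP[_]; case: s => [|x [|y s]] // _.
    move=> /increasing_seqP[_]; case: s' => [|x' [|y' s']] // _ /=.
    by move=> /einj->.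
  - move=> i s s' iJ _ _ _; apply: (@Etrans i a); first apply: Esym.
      by case: (eS (head 0 s)) => _; apply.
    by case: (eS (head 0 s')) => _; apply.
left.
have {}fin a : X a -> finite_set [set x | X x /\ forall i, i \in J -> E i a x].
  by move=> Xa; apply: contrapT => ainf; apply: fin; exists a.
have /choice[first Hfirst] : forall ix : I * T, exists n, X ix.2 ->
    (exists y, [/\ X y, g y = n & E ix.1 ix.2 y]) /\
    forall y, X y -> E ix.1 ix.2 y -> n <= g y.
  move=> [i x] /=; have [Xx|nX] := pselect (X x); last by exists 0.
  pose P n := `[< exists y, [/\ X y, g y = n & E i x y] >].
  have exP : exists n, P n by exists (g x); apply/asboolP; exists x.
  case: (ex_minnP exP) => n /asboolP Pn nmin; exists n => _; split=> // y Xy xy.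
  by apply: nmin; apply/asboolP; exists y.
pose chi x := [arg max_(i > j0 | i \in J) first (i, x)].
have chiP x : chi x \in J /\ forall i, i \in J -> first (i, x) <= first (chi x, x).
  by rewrite /chi; case: arg_maxnP.
exists chi; split=> [x _|a i]; first by case: (chiP x).
set S := [set x | _].
have [[b [Xb ab cb]]|noS] := pselect (exists b, S b); last first.
  rewrite (_ : S = set0); first exact: finite_set0.
  by apply/seteqP; split=> // x Sx; case: noS; exists x.
(* Once [S] contains [b], all values [first (i', x)] on [S] are at most [g b], so only finitely many
   vectors of such values occur. Each vector determines the classes for all colors in [J], and [fin]
   bounds its fiber. *)
have bound x i' : S x -> i' \in J -> first (i', x) <= g b.
  move=> [Xx ax cx] i'J; have [_ /(_ i' i'J)] := chiP x; move/leq_trans; apply.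
  have [_] := Hfirst (chi x, x) Xx; apply=> //=; rewrite cx.
  exact: Etrans (Esym ax) ab.
apply: (finite_set_fibers (c := fun x => [ffun i' => inord (first (i', x)) : 'I_(g b).+1])).
move=> k; have [[x [Sx xk]]|no] := pselect (exists x, S x /\
    [ffun i' => inord (first (i', x)) : 'I_(g b).+1] = k); last first.
  rewrite (_ : [set x | _] = set0); first exact: finite_set0.
  by apply/seteqP; split=> // x Sx; case: no; exists x.
have Xx : X x by case: Sx.
apply: sub_finite_set (fin x Xx) => y [Sy yk]; have Xy : X y by case: Sy.
split=> // i' i'J.
have e : first (i', x) = first (i', y).
  move/ffunP: xk => /(_ i'); rewrite -yk !ffunE => /(congr1 val) /=.
  by rewrite !inordK // ltnS; apply: bound.
have [[u [Xu gu xu]] _] := Hfirst (i', x) Xx.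
have [[v [Xv gv yv]] _] := Hfirst (i', y) Xy.
have uv : u = v by apply: ginj => //; rewrite gu gv.
by move: xu yv => /= xu yv; apply: Etrans xu _; rewrite uv; exact: Esym.
Qed.

(** Equality is included so that reflection keeps distinct points distinct. *)
Definition atoms (k : option I) : T -> T -> Prop := if k is Some i then E i else eq.

(** At stage [N] the points [f s] with entries of [s] below [N] are copied into [Y], away from all
    earlier copies and over the meeting points [c (s, i)]. The new cube takes its last entry as the
    stage. For [i] in [k], copies made at one stage keep the relations of [f]; for the other [i],
    every copy of [f s] is equivalent to [c (s, i)], whatever the stage. *)
Lemma weak_cube_extend (X Y : set T) (J k : {set I}) m f t :
  reflects atoms X Y -> Y `<=` X -> k \subset J -> ~~ (J \subset k) ->
  weak_cube k X m f t -> (forall s, increasing_seq m s -> ~ Y (f s)) ->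
  (forall i s, i \in J -> i \notin k -> increasing_seq m s ->
    exists2 c, Y c & E i (f s) c) ->
  exists f' t', weak_cube J X m.+1 f' t'.
Proof.
move=> refl YX kJ /fintype.subsetPn[i1 i1J i1k] [tm tonto fX finj fE] fY fc.
have /choice[c Hc] : forall si : seq nat * I, exists c, si.2 \in J -> si.2 \notin k ->
    increasing_seq m si.1 -> Y c /\ E si.2 (f si.1) c.
  move=> [s i]; case: (boolP [&& i \in J, i \notin k & increasing_seq m s]).
    by case/and3P=> iJ ik st; have [y Yy Ey] := fc i s iJ ik st; exists y.
  by move=> no; exists (f [::]) => /= iJ ik st; rewrite iJ ik st in no.
pose D N := [seq s <- words N m | sorted ltn s].
have DP N s : s \in D N -> increasing_seq m s.
  by rewrite mem_filter mem_words /increasing_seq => /and3P[-> -> _].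
have inD N s : increasing_seq m s -> all (gtn N) s -> s \in D N.
  by rewrite mem_filter mem_words /increasing_seq => /andP[-> ->].
have /choice[G HG] : forall NF : nat * seq T, exists psi : T -> T,
    let D := D NF.1 in (forall x, x \in NF.2 -> Y x) ->
    [/\ forall s, s \in D -> Y (psi (f s)) /\ psi (f s) \notin NF.2,
        forall s s', s \in D -> s' \in D -> psi (f s) = psi (f s') -> s = s',
        forall i s s', s \in D -> s' \in D -> E i (f s) (f s') ->
          E i (psi (f s)) (psi (f s')) &
        forall i s, s \in D -> i \in J -> i \notin k -> E i (psi (f s)) (c (s, i))].
  move=> [N F] /=; have [FY|nF] := pselect (forall x, x \in F -> Y x); last by exists id.
  pose p := F ++ [seq c (s, i) | s <- D N, i <- [seq i <- enum I | (i \in J) && (i \notin k)]].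
  have [||psi [psip psib psiE]] := refl p [seq f s | s <- D N].
  - move=> x; rewrite mem_cat => /orP[/FY//|/allpairsP[[s i] /= [sD]]].
    rewrite mem_filter mem_enum => /andP[/andP[iJ ik] _] ->.
    by case: (Hc (s, i) iJ ik (DP _ _ sD)).
  - by move=> x /mapP[s /DP sD ->]; exact: fX.
  have inb s : s \in D N -> f s \in p ++ [seq f s | s <- D N].
    by move=> sD; rewrite mem_cat map_f ?orbT.
  exists psi => _; split.
  - move=> s sD; split; first by apply: psib; exact: map_f.
    (* If the copy of [f s] were an old point, [psi] would fix it; as [psi] reflects equality, [f s]
       would equal its copy and lie in [Y]. *)
    apply/negP => sF; apply: (fY s (DP _ _ sD)).
    have pF : psi (f s) \in p by rewrite mem_cat sF.
    suff <- : psi (f s) = f s by exact: FY.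
    apply: (psiE None _ _ _ (inb s sD)).1; first by rewrite mem_cat pF.
    exact: psip.
  - move=> s s' sD s'D e; apply: finj; [exact: DP sD|exact: DP s'D|].
    exact: (psiE None _ _ (inb s sD) (inb s' s'D)).1.
  - by move=> i s s' sD s'D e; exact: (psiE (Some i) _ _ (inb s sD) (inb s' s'D)).2.
  - move=> i s sD iJ ik; have cp : c (s, i) \in p.
      rewrite mem_cat; apply/orP; right; apply/allpairsP; exists (s, i); split=> //=.
      by rewrite mem_filter iJ ik mem_enum.
    rewrite -(psip _ cp); apply: (psiE (Some i) _ _ (inb s sD) _).2.
      by rewrite mem_cat cp.
    by case: (Hc (s, i) iJ ik (DP _ _ sD)).
pose Fs := fix Fs N := if N is N'.+1
  then Fs N' ++ [seq G (N', Fs N') (f s) | s <- D N'] else [::].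
have FsY N x : x \in Fs N -> Y x.
  elim: N x => //= N IH x; rewrite mem_cat => /orP[/IH//|/mapP[s sD ->]].
  by have [/(_ s sD)[]] := HG (N, Fs N) IH.
pose g N s := G (N, Fs N) (f s).
have {HG} HG N := HG (N, Fs N) (@FsY N).
have gFs N N' s : N < N' -> s \in D N -> g N s \in Fs N'.
  elim: N' => // N' IH; rewrite ltnS leq_eqVlt /= mem_cat => /predU1P[<-|NN'] sD.
    by apply/orP; right; exact: map_f.
  by rewrite IH.
(* The last entry of [u] strictly bounds the others, so the initial part of [u] is among the tuples
   treated at that stage. *)
have split_seq u : increasing_seq m.+1 u ->
    [/\ increasing_seq m (take m u), take m u \in D (nth 0 u m) &
        u = rcons (take m u) (nth 0 u m)].
  move=> /increasing_seqP[us um].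
  have eu : u = rcons (take m u) (nth 0 u m).
    by rewrite -take_nth ?um // -um take_size.
  have ut : increasing_seq m (take m u).
    by rewrite /increasing_seq take_sorted //= size_take um ltnSn.
  split=> //; apply: inD => //; apply/(all_nthP 0) => l.
  rewrite size_take um ltnSn => lm; rewrite nth_take //=.
  by move/sorted_nthP: us; apply; rewrite ?um.
exists (fun u => g (nth 0 u m) (take m u)), (fun i => if i \in k then t i else m).
split.
- by move=> i iJ; case: ifP => // /tm /ltnW.
- move=> l; rewrite ltnS leq_eqVlt => /predU1P[->|/tonto[i ik ti]].
    by exists i1; rewrite // (negbTE i1k).
  by exists i; rewrite ?ik //; exact: (fintype.subsetP kJ).
- move=> u /split_seq[_ uD _]; apply: YX; have [/(_ _ uD)[+ _] _ _ _] := HG (nth 0 u m).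
  by [].
- move=> u v /split_seq[_ uD ->] /split_seq[_ vD ->].
  move: (take m u) (nth 0 u m) (take m v) (nth 0 v m) uD vD => s N s' N' sD s'D.
  have sm : size s = m by case/increasing_seqP: (DP _ _ sD).
  have sm' : size s' = m by case/increasing_seqP: (DP _ _ s'D).
  rewrite !nth_rcons sm sm' ltnn eqxx -!cats1 !take_cat sm sm' ltnn subnn !cats0.
  move=> e; case: (ltngtP N N') => NN'.
  + have [/(_ _ s'D)[_ +] _ _ _] := HG N'; rewrite -/(g N' s') -e.
    by rewrite gFs.
  + have [/(_ _ sD)[_ +] _ _ _] := HG N; rewrite -/(g N s) e.
    by rewrite gFs.
  + rewrite -{}NN' in s'D e *; have [_ inj _ _] := HG N.
    by rewrite (inj s s').
- move=> i u v iJ /split_seq[ut uD _] /split_seq[vt vD _].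
  case: ifP => [ik|/negbT ik] uv.
    have em : nth 0 u m = nth 0 v m by apply: uv; rewrite gtn_eqF // tm.
    rewrite -em in vD *; have [_ _ H _] := HG (nth 0 u m); apply: H => //.
    apply: fE => // l lt; case: (ltnP l m) => lm; first by rewrite !nth_take // uv.
    rewrite !nth_default //; last by case/increasing_seqP: ut => _ ->.
    by case/increasing_seqP: vt => _ ->.
  have et : take m u = take m v.
    have [[_ su] [_ sv]] := (increasing_seqP ut, increasing_seqP vt).
    apply: (@eq_from_nth _ 0); rewrite su ?sv // => l lm.
    by rewrite !nth_take //; apply: uv; rewrite ltn_eqF.
  have [_ _ _ H] := HG (nth 0 u m); have [_ _ _ H'] := HG (nth 0 v m).
  apply: Etrans (H i _ uD iJ ik) (Esym _); rewrite et; exact: H'.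
Qed.

Lemma dichotomy j J X : small j X -> colorable J X \/ has_weak_cube j.+1 J X.
Proof.
elim: j J X => [|j IH] J X; first exact: countable_dichotomy.
move=> [W [le [rk [wo smX]]]].
have lexx w : le w w by case: (wo_total wo w w).
have [op [opX opR]] := skolem atoms X.
pose Xw w := op_closure op [set x | X x /\ le (rk x) w].
have XwX w x : Xw w x -> X x by case=> [y []|c s y _ /opX].
have Xwm v w : le v w -> Xw v `<=` Xw w.
  by move=> vw; apply: op_closure_mono => x [Xx xv]; split=> //; exact: wo_trans xv vw.
have /choice[lev Hlev] : forall x, exists w, X x -> Xw w x /\ forall v, Xw v x -> le w v.
  move=> x; have [Xx|no] := pselect (X x); last by exists (rk x).
  have [|w [Hw wm]] := wo_min wo (P := [set w | Xw w x]); last by exists w.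
  by exists (rk x); apply: op_closure_in.
pose Y w := [set y | exists2 v, ~ le w v & Xw v y].
(* A finite list from [Y w] lies in a single [Xw v] by totality of the order. Nonemptiness provides
   such a [v] for the empty list. *)
have Yrefl w : Y w !=set0 -> reflects atoms X (Y w).
  move=> [y0 [v0 wv0 _]]; apply: opR => c s sY z zs.
  suff [v wv sv] : exists2 v, ~ le w v & forall z, z \in s -> Xw v z.
    by exists v => //; exact: op_closure_op sv zs.
  elim: s sY {zs} => [|y s IHs] sY; first by exists v0.
  have [v wv sv] := IHs (fun v' v's => sY v' (mem_behead (s := y :: s) v's)).
  have [v' wv' yv'] := sY y (mem_head _ _).
  case: (wo_total wo v v') => vv'.
    by exists v' => // x; rewrite inE => /predU1P[->//|/sv]; exact: Xwm.
  by exists v => // x; rewrite inE => /predU1P[->|/sv //]; exact: Xwm yv'.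
pose free x := [set i in J | ~~ `[< exists2 c, Y (lev x) c & E i x c >]]%SET.
pose L (wk : W * {set I}) := [set x | [/\ X x, lev x = wk.1 & free x = wk.2]].
have Lsmall wk : small j (L wk).
  apply: small_sub (op_closure_small op (smX wk.1)) => x [Xx <- _].
  by case: (Hlev x Xx).
have [allcol|] := pselect (forall wk, colorable wk.2 (L wk)).
  left; have /choice[chi Hchi] := allcol.
  exists (fun x => chi (lev x, free x) x); split.
    move=> x Xx; have [/(_ x)] := Hchi (lev x, free x).
    by move=> /(_ (And3 Xx erefl erefl)); rewrite /= inE => /andP[].
  move=> a i; set S := [set x | _].
  have [S0|noS] := pselect (lev @` S !=set0); last first.
    rewrite (_ : S = set0); first exact: finite_set0.
    by apply/seteqP; split=> // x Sx; case: noS; exists (lev x), x.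
  (* All points of [S] share the least level [w0]: at a higher level, [x0] would lie in the earlier
     part and meet the class of the point, so [i] would not be free there. *)
  have [w0 [[x0 [Xx0 ax0 cx0] ex0] w0min]] := wo_min wo S0.
  have Slev x : S x -> lev x = w0.
    move=> Sx; have w0x : le w0 (lev x) by apply: w0min; exists x.
    apply: contrapT => ne; have [Xx ax cx] := Sx.
    have [/(_ x (And3 Xx erefl erefl))] := Hchi (lev x, free x).
    rewrite /= cx inE => /andP[_ /asboolP + _]; apply.
    exists x0; last exact: Etrans (Esym ax) ax0.
    exists w0; first by move=> xw0; apply: ne; exact: wo_anti xw0 w0x.
    by rewrite -ex0; case: (Hlev x0 Xx0).
  apply: (finite_set_fibers (c := free)) => k.
  have [_ /(_ a i)] := Hchi (w0, k); apply: sub_finite_set => x [Sx xk].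
  have ew := Slev x Sx; have [Xx ax] := Sx; rewrite ew xk => cx.
  by split.
move=> /existsNP[[w k] /= ncol]; right.
have [//|[m [f [t [mj fc]]]]] := IH k _ (Lsmall (w, k)).
have fL s : increasing_seq m s -> L (w, k) (f s) by apply: (wc_val fc).
have iota_inc : increasing_seq m (iota 0 m).
  by rewrite /increasing_seq iota_ltn_sorted size_iota eqxx.
have kJ : k \subset J.
  have [_ _ /= <-] := fL _ iota_inc; apply/fintype.subsetP => i; by rewrite inE => /andP[].
have fcX : weak_cube k X m f t by case: fc => ? ? ? ? ?; split=> // s /fL[].
(* If all colors are free the cube already serves [J]; otherwise the colors outside [k] cost one
   more dimension. *)
have [Jk|nJk] := boolP (J \subset k).
  exists m, f, t; split; first exact: ltnW.
  by rewrite (_ : J = k) //; apply/eqP; rewrite finset.eqEsubset Jk kJ.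
have fY i s : i \in J -> i \notin k -> increasing_seq m s ->
    exists2 c, Y w c & E i (f s) c.
  move=> iJ ik /fL[_ /= ew ek]; move: ik; rewrite -ek inE iJ /= negbK ew.
  by move/asboolP.
have Yw0 : Y w !=set0.
  have /fintype.subsetPn[i iJ ik] := nJk.
  by have [c Yc _] := fY i _ iJ ik iota_inc; exists c.
have [||f' [t' fc']] := weak_cube_extend (Yrefl w Yw0) _ kJ nJk fcX _ fY.
- by move=> y [v _ /XwX].
- move=> s /fL[Xs /= ew _] [v wv sv]; apply: wv; rewrite -ew.
  by have [_] := Hlev _ Xs; apply.
- by exists m.+1, f', t'; split=> //; rewrite ltnS.
Qed.

End Dichotomy.

(** * From weak cubes to halfcubes *)

(* Turns an increasing [n]-tuple into an increasing [m+1]-tuple by encoding all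
   entries from position [m] on in a single number. *)
Definition fold_tail m (s : seq nat) := rcons (take m s) (CodeSeq.code (drop m s)).

Lemma fold_tail_increasing m n s : m < n -> increasing_seq n s ->
  increasing_seq m.+1 (fold_tail m s).
Proof.
move=> mn /increasing_seqP[ss sn].
have st : size (take m s) = m by rewrite size_take sn mn.
rewrite /increasing_seq size_rcons st eqxx andbT; apply/sorted_nthP => k l kl.
rewrite size_rcons st ltnS => lm; rewrite !nth_rcons st (leq_trans kl lm).
rewrite nth_take ?(leq_trans kl lm) //; case: (ltngtP l m) lm => // [lm _|e _].
  by rewrite nth_take //; move/sorted_nthP: ss; apply; rewrite // sn (ltn_trans lm).
apply: leq_trans (_ : nth 0 s m < _).
  by rewrite ltnS ltnW //; move/sorted_nthP: ss; apply; rewrite ?sn // -e.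
(* The code of a list exceeds each of its entries, here the one at position [m]. *)
have /allP := CodeSeq.ltn_code (drop m s); apply.
by rewrite (drop_nth 0) ?sn // mem_head.
Qed.

Lemma fold_tail_inj m n s s' : m < n -> size s = n -> size s' = n ->
  fold_tail m s = fold_tail m s' -> s = s'.
Proof.
move=> mn sn sn' /rcons_inj[et /(can_inj CodeSeq.codeK) ed].
by rewrite -(cat_take_drop m s) et ed cat_take_drop.
Qed.

Lemma fold_tail_nth m n s s' k : m < n -> k <= m -> size s = n -> size s' = n ->
  (forall l, l != k -> nth 0 s l = nth 0 s' l) ->
  forall l, l != k -> nth 0 (fold_tail m s) l = nth 0 (fold_tail m s') l.
Proof.
move=> mn km sn sn' ss l lk; rewrite !nth_rcons !size_take sn sn' mn.
case: (ltngtP l m) => // [lm|e]; first by rewrite !nth_take // ss.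
congr CodeSeq.code; apply: (@eq_from_nth _ 0); rewrite !size_drop sn ?sn' // => p pn.
rewrite !nth_drop; apply: ss; apply/eqP => e'; move: lk; rewrite e; lia.
Qed.

Lemma eclassE n (A : hyperspace n) i (x y : A) :
  eclass i x = eclass i y <-> hrel i x y.
Proof.
have [r sy tr] := hrel_equiv A i; split=> [e|xy].
  have : eclass i y y by exact: r.
  by rewrite -e.
apply/seteqP; split=> z; first by apply: tr; exact: sy.
exact: tr.
Qed.

Lemma tau_ltP n m (S : 'I_n -> {set 'I_m}) (T : {set 'I_m}) d :
  hits_all S T -> #|T| < d -> tau_lt S d.
Proof.
move=> hT Td; have Sne i : S i != finset.set0.
  move/forallP: hT => /(_ i); apply: contra => /eqP->; by rewrite finset.setI0.
rewrite /tau_lt /tau ifF; last by apply/existsP => -[i]; rewrite (negbTE (Sne i)).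
case: arg_minnP => [|U _ Umin]; last exact: leq_ltn_trans (Umin T hT) Td.
by apply/forallP => i; rewrite finset.setTI.
Qed.

Section FfunSeq.
Variable n : nat.
Implicit Type x : {ffun 'I_n -> nat}.

Definition seq_of_ffun x := [seq x k | k <- enum 'I_n].

Lemma size_seq_of_ffun x : size (seq_of_ffun x) = n.
Proof. by rewrite size_map size_enum_ord. Qed.

Lemma nth_seq_of_ffun x (k : 'I_n) : nth 0 (seq_of_ffun x) k = x k.
Proof. by rewrite (nth_map k) ?size_enum_ord // nth_ord_enum. Qed.

Lemma seq_of_ffun_increasing x : increasing x -> increasing_seq n (seq_of_ffun x).
Proof.
move=> xi; rewrite /increasing_seq size_seq_of_ffun eqxx andbT.
apply/sorted_nthP => k l kl; rewrite size_seq_of_ffun => ln.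
have := xi (Ordinal (ltn_trans kl ln)) (Ordinal ln) kl.
by rewrite -!nth_seq_of_ffun.
Qed.

End FfunSeq.

(** The complement appears because [S i] lists the coordinates that [E_i] ignores, while [C i] lists
    those that determine the class. *)
Lemma embeds_halfcube n (A : hyperspace n) (g : seq nat -> A)
    (C : 'I_n -> {set 'I_n}) :
  (forall s s', increasing_seq n s -> increasing_seq n s' -> g s = g s' -> s = s') ->
  (forall i s s', increasing_seq n s -> increasing_seq n s' ->
    hrel i (g s) (g s') <-> forall j, j \in C i -> nth 0 s j = nth 0 s' j) ->
  embeds A (halfcube (fun i => finset.setC (C i))).
Proof.
move=> ginj gC.
exists (fun x : halfcube (fun i => finset.setC (C i)) => g (seq_of_ffun (val x))).
have xi (x : halfcube (fun i => finset.setC (C i))) : increasing_seq n (seq_of_ffun (val x)).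
  by apply: seq_of_ffun_increasing; exact: set_mem (valP x).
split=> [x y e|x y i].
  apply: val_inj; apply/ffunP => k; rewrite -!nth_seq_of_ffun.
  by rewrite (ginj _ _ (xi x) (xi y) e).
rewrite !eclassE gC //; split=> H j jC.
  rewrite !nth_seq_of_ffun; apply: H; by rewrite inE negbK.
by rewrite -!nth_seq_of_ffun; apply: H; move: jC; rewrite inE negbK.
Qed.

(** After stretching the cube to [n]-tuples and thinning it canonically, coordinate [t i] cannot
    belong to [C i]. Hence the first [m] coordinates meet every complement of [C i]. *)
Lemma halfcube_of_weak_cube (n d : nat) (A : hyperspace n) f t m :
  0 < n -> m <= d ->
  @weak_cube 'I_n {classic A} (@hrel n A) finset.setT setT m f t ->
  exists2 S : 'I_n -> {set 'I_n}, tau_lt S d.+1 & embeds A (halfcube S).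
Proof.
move=> n0 md [tm tonto _ finj fE].
have {}tm i : t i < m by apply: tm; rewrite inE.
have mn : m <= n.
  have /choice[u Hu] : forall k : 'I_m, exists i, t i = k.
    by move=> k; have [i _ e] := tonto k (ltn_ord k); exists i.
  have uinj : injective u by move=> k l e; apply: val_inj; rewrite /= -!Hu e.
  by have := leq_card _ uinj; rewrite !card_ord.
have tn i : t i < n := leq_trans (tm i) mn.
(* Since [n] is positive, [t] takes a value below the dimension, which is therefore a successor, the
   form that [fold_tail] produces. *)
case: m => [|m] in md tm tonto finj fE mn *; first by have := tm (Ordinal n0).
pose g (s : seq nat) : A := f (fold_tail m s).
have ginj s s' : increasing_seq n s -> increasing_seq n s' -> g s = g s' -> s = s'.
  move=> si si' e; have [[_ sn] [_ sn']] := (increasing_seqP si, increasing_seqP si').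
  by apply: (fold_tail_inj mn sn sn'); apply: finj e; apply: (fold_tail_increasing mn).
have gE i s s' : increasing_seq n s -> increasing_seq n s' ->
    (forall k, k != t i -> nth 0 s k = nth 0 s' k) -> hrel i (g s) (g s').
  move=> si si' ss'; apply: fE; rewrite ?inE //; try exact: (fold_tail_increasing mn).
  have [[_ sn] [_ sn']] := (increasing_seqP si, increasing_seqP si').
  by apply: (fold_tail_nth mn) => //; exact: tm.
have [|h mh [C hC]] := @canonical_ramsey 'I_n n (fun i s s' => hrel i (g s) (g s')).
  by move=> i; have [r sy tr] := hrel_equiv A i; split=> [x|x y|x y z]; [exact: r|exact: sy|exact: tr].
have hinc s : increasing_seq n s -> increasing_seq n (map h s).
  by rewrite /increasing_seq size_map strictly_mono_sorted.
(* Even entries leave room to raise coordinate [t i] by one. The raise keeps the class, so this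
   coordinate cannot be canonical. *)
have tC i : Ordinal (tn i) \notin C i.
  apply/negP => tiC; pose s := mkseq (muln 2) n.
  have sE k : k < n -> nth 0 s k = 2 * k by move=> kn; rewrite nth_mkseq.
  have sn : size s = n by rewrite size_mkseq.
  have si : increasing_seq n s.
    rewrite /increasing_seq sn eqxx andbT; apply/sorted_nthP => k l kl.
    by rewrite sn => ln; rewrite !sE ?(ltn_trans kl ln) //; lia.
  pose s' := update s (t i) (2 * t i).+1.
  have sE' k : k < n -> nth 0 s' k = if k == t i then (2 * t i).+1 else 2 * k.
    by move=> kn; rewrite nth_update ?sn // sE.
  have sn' : size s' = n by rewrite size_update.
  have si' : increasing_seq n s'.
    rewrite /increasing_seq sn' eqxx andbT; apply/sorted_nthP => k l kl.
    rewrite sn' => ln; rewrite !sE' ?(ltn_trans kl ln) //.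
    by case: eqP => [?|?]; case: eqP => [?|?]; lia.
  have [[ss _] [ss' _]] := (increasing_seqP si, increasing_seqP si').
  have Ess' : hrel i (g (map h s)) (g (map h s')).
    apply: gE; try exact: hinc; move=> k kt.
    case: (ltnP k n) => kn; last by rewrite !nth_default // size_map ?sn ?sn'.
    by rewrite (nth_map 0 0 h) ?sn // (nth_map 0 0 h) ?sn' // sE // sE' // (negbTE kt).
  have := (hC i s s' ss ss' sn sn').1 Ess' _ tiC.
  by rewrite sE ?sE' //= ?eqxx; lia.
exists (fun i => finset.setC (C i)); last first.
  apply: (@embeds_halfcube n A (g \o map h)) => [s s' si si' /ginj e|i s s' si si'].
    by apply: (inj_map (strictly_mono_inj mh)); apply: e; exact: hinc.
  by have [[ss sn] [ss' sn']] := (increasing_seqP si, increasing_seqP si'); exact: hC.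
apply: (@tau_ltP _ _ _ [set widen_ord mn k | k in 'I_m.+1]%SET).
  apply/forallP => i; apply/set0Pn; exists (Ordinal (tn i)).
  rewrite !inE tC andbT; apply/imsetP; exists (Ordinal (tm i)) => //.
  exact: val_inj.
by rewrite ltnS (leq_trans (leq_imset_card _ _)) // card_ord.
Qed.

Theorem theorem4p5 (d n : nat) (hd : 1 <= d) (A : hyperspace n)
    (hA : forall S : 'I_n -> {set 'I_n}, tau_lt S d -> ~ embeds A (halfcube S))
    (hcard : card_lt_aleph A d.-1) :
  exists chi : A -> 'I_n, acceptable chi.
Proof.
case: n => [|n] in A hA hcard *.
  (* With [n = 0] the halfcube is a single point of transversal number 0, so [A] must be empty. *)
  have noA (a : A) : False.
    apply: (hA (fun=> finset.set0)).
      by apply: (@tau_ltP _ _ _ finset.set0); rewrite ?cards0 //; apply/forallP => -[].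
    exists (fun=> a); split=> [x y _|x y []//].
    by apply: val_inj; apply/ffunP => -[].
  by exists (fun a => False_rect _ (noA a)) => a; case: (noA a).
(* For [d = 1] the carrier is finite and any coloring works. *)
case: d => [//|[|d]] in hd hA hcard *.
  have [T [/= Tnat [_ nTA]]] := hcard.
  exists (fun=> ord0) => a i; apply: sub_finite_set (_ : finite_set [set: A]) => //.
  apply: contrapT => /infiniteP natA; apply: nTA.
  by rewrite (card_le_eql Tnat).
(* After the shift of [d] by two, the dichotomy yields dimension at most [d + 1], hence a
   transversal number below [d + 2]. *)
have smA : small d [set: {classic A}] by exact: card_lt_aleph_small.
have := @dichotomy 'I_n.+1 ord0 {classic A} (@hrel _ A) (hrel_equiv A) d finset.setT _ smA.
case=> [[chi [_ fin]]|[m [f [t [md fc]]]]].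
  exists chi => a i; apply: sub_finite_set (fin a i) => x [ax cx]; by split.
have [//|S Sd SA] := halfcube_of_weak_cube _ md fc.
by case: (hA S Sd).
Qed.
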